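(* Let $l_1,l_2,l_3$ be positive integers with $l_1=\min\{l_1,l_2,l_3\}$, $l_2\ge 2$ and $l_3\ge 2$, and let $G=\Theta(l_1,l_2,l_3)$. Then $G$ is not enumeratively chromatic-choosable if and only if $l_1,l_2,l_3$ all have the same parity and $\{l_1,l_2,l_3\}\neq\{2\}$.
   Context: All graphs are finite and simple. For positive integers $l_1,l_2,l_3$, the theta graph $\Theta(l_1,l_2,l_3)$ consists of two end vertices joined by three internally disjoint paths of lengths (numbers of edges) $l_1,l_2,l_3$. A list assignment $L$ for a graph $G$ assigns to each vertex $v$ a set $L(v)$ of colors; it is an $m$-assignment if $|L(v)|=m$ for all $v$. A proper $L$-coloring is a proper coloring $f$ with $f(v)\in L(v)$ for all $v$, and $P(G,L)$ is the number of proper $L$-colorings. For $m\in\mathbb{N}$, the chromatic polynomial $P(G,m)$ is the number of proper colorings of $G$ with colors from $\{1,\dots,m\}$, and the list color function $P_\ell(G,m)$ is the minimum of $P(G,L)$ over all $m$-assignments $L$ for $G$. A graph $G$ is enumeratively chromatic-choosable if $P_\ell(G,m)=P(G,m)$ for every $m\in\mathbb{N}$. *)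

(* Defs.v *)
From mathcomp Require Import all_boot.
Set Implicit Arguments. Unset Strict Implicit. Unset Printing Implicit Defensive.

(** A finite simple graph is a finType V with a symmetric irreflexive
    relation e : rel V (adjacency). *)

Section Coloring.
Variables (V : finType) (e : rel V).

Definition proper_coloring (C : eqType) (f : V -> C) : bool :=
  [forall x, forall y, e x y ==> (f x != f y)].

Definition chrom_poly (m : nat) : nat :=
  #|[set f : {ffun V -> 'I_m} | proper_coloring (fun v => (f v : nat)) ]|.

Definition m_assignment (L : V -> seq nat) (m : nat) : Prop :=
  forall v, uniq (L v) /\ size (L v) = m.

Definition color_bound (L : V -> seq nat) : nat :=
  (\max_(v : V) \max_(c <- L v) c).+1.

(** Number of proper L-colorings. Every L-coloring takes values below
    color_bound L, so counting functions into 'I_(color_bound L) is exact. *)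
Definition num_L_colorings (L : V -> seq nat) : nat :=
  #|[set f : {ffun V -> 'I_(color_bound L)} |
      [forall v, (f v : nat) \in L v] &&
      proper_coloring (fun v => (f v : nat)) ]|.

Definition is_list_color_function (m k : nat) : Prop :=
  (exists L, m_assignment L m /\ num_L_colorings L = k) /\
  (forall L, m_assignment L m -> k <= num_L_colorings L).

Definition enum_chromatic_choosable : Prop :=
  forall m, is_list_color_function m (chrom_poly m).

End Coloring.

(** Theta graph Theta(l1,l2,l3): the two end vertices are [inl false]
    (position 0 on each path) and [inl true] (position l_i on path i); the
    internal vertices of path i are [inr (existT i k)], k < l_i - 1, at
    position k+1 on path i. Two vertices are adjacent iff they lie on a common
    path at consecutive positions. *)
Definition theta_len (l1 l2 l3 : nat) (i : 'I_3) : nat := nth 0 [:: l1; l2; l3] i.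

Definition theta_vertex (l1 l2 l3 : nat) : finType :=
  (bool + {i : 'I_3 & 'I_(theta_len l1 l2 l3 i).-1})%type.

Definition theta_pos (l1 l2 l3 : nat) (i : 'I_3) (x : theta_vertex l1 l2 l3)
  : option nat :=
  match x with
  | inl false => Some 0
  | inl true => Some (theta_len l1 l2 l3 i)
  | inr (existT j k) => if j == i then Some (k : nat).+1 else None
  end.

Definition theta_adj (l1 l2 l3 : nat) : rel (theta_vertex l1 l2 l3) :=
  fun x y => [exists i : 'I_3,
    match theta_pos i x, theta_pos i y with
    | Some a, Some b => (a.+1 == b) || (b.+1 == a)
    | _, _ => false
    end].
Arguments theta_adj : clear implicits.

(* Main.v *)
Require Import Defs.
From mathcomp Require Import all_boot all_order all_algebra.
From mathcomp Require Import zify ring.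
Set Implicit Arguments. Unset Strict Implicit. Unset Printing Implicit Defensive.
Import Order.TTheory GRing.Theory Num.Theory.
Local Open Scope ring_scope.

(** Fixing the colors a, b of the two ends, a list coloring of the theta graph is a
    product of three path colorings, so everything is expressed with the numbers
    N_i(a,b) of colorings of the interior of the i-th path.  Replacing each partial
    matching "equal colors" between consecutive lists by a full bijection gives, for a
    path of length l, N(a,b) >= x_l + (-1)^l [b = f(a)] for some bijection f between
    the end lists, with equality and f = id when all lists agree.

    If the lengths do not have the same parity, two paths, say 1 and 2, form an even
    cycle of length at least 4 and l_3 has the other parity.  For m >= 3 the even cycle
    has at least as many list colorings as ordinary ones.  Summing
    N_1 N_2 (x_3 +- [b = f_3(a)]) over a, b, with this bound on the sum of N_1 N_2 and
    the pointwise bounds on N_1 N_2 on or off the graph of f_3, yields exactly P(G,m).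
    For m <= 2 the value P(G,m) is 0.  The graph K_{2,3} is handled by a direct count.

    If the lengths do have the same parity then P(G,2) = 2, and 2-assignments with at
    most one coloring exist for (1,3,3) and (2,2,4); inserting two more copies of the
    list of an end vertex next to it changes no count, which covers all lengths. *)

(** * Sums over lists of colors *)

Lemma sum_const (A : seq nat) (x : int) : \sum_(a <- A) x = (size A)%:R * x.
Proof. by rewrite big_const_seq count_predT iter_addr_0 mulr_natl. Qed.

Lemma sum_indicator (A : seq nat) (P : pred nat) :
  \sum_(a <- A) (P a)%:R = (count P A)%:R :> int.
Proof.
by rewrite -sum1_count natr_sum [RHS]big_mkcond; apply: eq_bigr => a _; case: (P a).
Qed.

Lemma ler_sum_seq (T : eqType) (A : seq T) (F G : T -> int) :
  {in A, forall a, F a <= G a} -> \sum_(a <- A) F a <= \sum_(a <- A) G a.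
Proof.
move=> h; rewrite big_seq_cond [X in _ <= X]big_seq_cond.
by apply: ler_sum => a; rewrite andbT; apply: h.
Qed.

Lemma sum_mem_eq (A : seq nat) (F : nat -> int) b : uniq A ->
  \sum_(a <- A) (b == a)%:R * F a = (b \in A)%:R * F b.
Proof.
move=> uA; case: (boolP (b \in A)) => bA.
  rewrite (bigD1_seq b) //= eqxx big1 ?addr0 // => i /negPf.
  by rewrite eq_sym => ->; rewrite mul0r.
rewrite mul0r big1_seq // => a /andP[_ aA].
by case: eqP bA => [->|]; rewrite ?aA ?mul0r.
Qed.

(** * Colorings of a path with given end colors *)

Definition is_list (m : nat) (A : seq nat) : bool := uniq A && (size A == m).

(* The number of colorings of the inner vertices, with lists [s], of a path whose ends
   have colors [a] and [b]; the path has [size s + 1] edges. *)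
Fixpoint path_count (s : seq (seq nat)) (a b : nat) : int :=
  if s is C :: s' then \sum_(c <- C) (a != c)%:R * path_count s' c b
  else (a != b)%:R.

(* [walk m l = ((m - 1)^l - (-1)^l) / m]: proper [m]-colorings of the interior of a path
   of length [l] whose ends have two given distinct colors. *)
Fixpoint walk (m l : nat) : int :=
  if l is l'.+1 then (m%:R - 1) * walk m l' + (-1) ^+ l' else 0.

(** Only injectivity is asked: between lists of equal size it makes [f] a bijection. *)
Definition transport (A B : seq nat) (f : nat -> nat) : Prop :=
  {in A, forall a, f a \in B} /\ {in A &, injective f}.

(** As the sizes agree, [A] minus [B] and [B] minus [A] have equally many colors; these are matched
    by index and the common colors stay fixed. *)
Lemma transport_exists m A B : is_list m A -> is_list m B ->
  exists2 f, transport A B f & {in A, forall a, a \in B -> f a = a}.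
Proof.
move=> /andP[uA /eqP sA] /andP[uB /eqP sB].
pose A' := filter (predC (mem B)) A; pose B' := filter (predC (mem A)) B.
have sAB : size A' = size B'.
  have e3 : count (mem B) A = count (mem A) B.
    rewrite -!size_filter; apply/perm_size/uniq_perm; rewrite ?filter_uniq //.
    by move=> c; rewrite !mem_filter andbC.
  rewrite !size_filter; apply/eqP; rewrite -(eqn_add2l (count (mem B) A)).
  by rewrite {2}e3 !count_predC sA sB.
have iA c : c \in A -> c \notin B -> (index c A' < size A')%N.
  by move=> cA cB; rewrite index_mem mem_filter /= cA andbT.
have inB' a : a \in A -> a \notin B ->
    (nth 0%N B' (index a A') \in B) && (nth 0%N B' (index a A') \notin A).
  move=> aA aB; have : nth 0%N B' (index a A') \in B'.
    by rewrite mem_nth // -sAB iA.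
  by rewrite mem_filter andbC.
exists (fun a => if a \in B then a else nth 0%N B' (index a A')); last first.
  by move=> a _ ->.
split.
- move=> a aA; case: ifPn => // aB.
  by have /andP[] := inB' _ aA aB.
- move=> a a' aA a'A; case: ifPn => aB; case: ifPn => a'B //.
  + by move=> e; have /andP[_] := inB' _ a'A a'B; rewrite -e aA.
  + by move=> e; have /andP[_] := inB' _ aA aB; rewrite e a'A.
  move=> /eqP; rewrite nth_uniq -?sAB ?iA ?filter_uniq // => /eqP e.
  by apply: (@index_inj _ 0%N A') => //; rewrite mem_filter /= ?aB ?a'B.
Qed.

Lemma transport_sum m A B f (F : nat -> int) : is_list m A -> is_list m B ->
  transport A B f ->
  \sum_(a <- A) F (f a) = \sum_(b <- B) F b.
Proof.
move=> /andP[uA /eqP sA] /andP[uB /eqP sB] [fB fI].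
rewrite -(big_map f predT F); apply: perm_big.
have ufA : uniq (map f A) by rewrite map_inj_in_uniq.
have sub : {subset map f A <= B} by move=> _ /mapP[a aA ->]; apply: fB.
have [|_ eAB] := uniq_min_size ufA sub; first by rewrite size_map sA sB.
by apply: uniq_perm.
Qed.

Lemma walk_even_odd m l : (2 <= m)%N -> 0 <= walk m l /\ (odd l -> 1 <= walk m l).
Proof.
move=> m2; elim: l => [//|l [IH0 IH1]] /=.
rewrite -signr_odd; case: (odd l) IH1 => /= [/(_ isT)|_] /=.
  by rewrite expr1 => h; split => //; nia.
by rewrite expr0; split => [|_]; nia.
Qed.

(* The bijection comes from composing along the path bijections between consecutive
   lists that fix the common colors. *)
Lemma path_count_ge m s A B : (2 <= m)%N -> is_list m A -> is_list m B ->
  all (is_list m) s -> exists2 f, transport A B f &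
  {in A & B, forall a b,
    walk m (size s).+1 + (-1) ^+ (size s).+1 * (b == f a)%:R <= path_count s a b}.
Proof.
move=> m2; elim: s A => [|C s IH] A vA vB.
  move=> _; have [f fT fid] := transport_exists vA vB; exists f => // a b aA bB /=.
  rewrite mulr0 expr0 expr1 add0r.
  case: (eqVneq a b) => [e|_]; last by case: (b == _).
  by rewrite e in aA *; rewrite fid // eqxx.
move=> /= /andP[vC vs]; have [f fT fge] := IH C vC vB vs.
have [g gT gid] := transport_exists vA vC.
have [[fB fI] [gC gI]] := (fT, gT).
exists (f \o g).
  split=> [a aA|a a' aA a'A /= e]; first exact/fB/gC.
  by apply: gI => //; apply: fI => //; apply: gC.
move=> a b aA bB.
set l := (size s).+1 in fge *.
have [w0 w1] := walk_even_odd l m2.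
(* Needed to multiply inequalities. For odd [l] the sign is negative, and [walk m l >= 1]
   compensates. *)
have pos c : 0 <= walk m l + (-1) ^+ l * (b == f c)%:R.
  move: (walk m l) w0 w1 => w w0; rewrite -signr_odd.
  by case: (odd l) => [/(_ isT)|_]; case: (b == _) => /=; rewrite ?expr0 ?expr1; lia.
(* Excluding [c = g a] instead of [c = a] never excludes less: if [a] lies in [C], then
   [g a = a]. *)
have step c : c \in C ->
   (1 - (g a == c)%:R) * (walk m l + (-1) ^+ l * (b == f c)%:R)
     <= (a != c)%:R * path_count s c b.
  move=> cC; apply: ler_pM => //; last exact: fge.
    by case: (_ == _).
  case: (eqVneq a c) => [e|_] /=; last by case: (_ == _).
  by move: cC; rewrite -e => aC; rewrite gid // eqxx.
apply: le_trans (_ : \sum_(c <- C)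
  (1 - (g a == c)%:R) * (walk m l + (-1) ^+ l * (b == f c)%:R) <= _).
  under eq_bigr do rewrite mulrBl mul1r.
  rewrite sumrB sum_mem_eq; last by case/andP: vC.
  rewrite gC // mul1r big_split /= sum_const.
  rewrite (transport_sum (fun c => (-1) ^+ l * (b == c)%:R) vC vB fT).
  under eq_bigr do rewrite mulrC.
  rewrite sum_mem_eq; last by case/andP: vB.
  rewrite bB mul1r; case/andP: vC => _ /eqP ->.
  by rewrite /l /= !exprS le_eqVlt; apply/orP; left; apply/eqP; ring.
exact: ler_sum_seq.
Qed.

(** With equal lists the bijection is the identity and no estimate loses anything. Equality up to
    order suffices. *)
Lemma path_count_const s A a b : uniq A -> all (perm_eq A) s -> a \in A -> b \in A ->
  path_count s a b =
    walk (size A) (size s).+1 + (-1) ^+ (size s).+1 * (b == a)%:R.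
Proof.
move=> uA; elim: s a => [|C s IH] a.
  by move=> _ _ _ /=; rewrite eq_sym; case: (b == a) => /=; ring.
move=> /= /andP[AC As] aA bA.
rewrite -(perm_big _ AC) /=.
set l := (size s).+1 in IH *.
transitivity (\sum_(c <- A) (1 - (a == c)%:R) *
                (walk (size A) l + (-1) ^+ l * (b == c)%:R)).
  by apply: eq_big_seq => c cA; rewrite IH //; case: (a == c) => /=; ring.
under eq_bigr do rewrite mulrBl mul1r.
rewrite sumrB sum_mem_eq // aA mul1r big_split /= sum_const.
under eq_bigr do rewrite mulrC.
by rewrite sum_mem_eq // bA /l /= !exprS; ring.
Qed.

(** Cutting the path at the vertex with list [C] makes the two halves independent once its color is
    fixed. *)
Lemma path_count_cat s1 C s2 a b :
  path_count (s1 ++ C :: s2) a b =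
    \sum_(c <- C) path_count s1 a c * path_count s2 c b.
Proof.
elim: s1 a => [//|D s1 IH] a /=.
under eq_bigr do rewrite IH mulr_sumr.
rewrite exchange_big /=; apply: eq_bigr => c _; rewrite mulr_suml.
by apply: eq_bigr => d _; rewrite mulrA.
Qed.

Lemma path_count_rev s a b : path_count (rev s) a b = path_count s b a.
Proof.
elim: s a b => [|C s IH] a b; first by rewrite /= eq_sym.
rewrite rev_cons -cats1 path_count_cat /=; apply: eq_bigr => c _.
by rewrite IH mulrC eq_sym.
Qed.

(** * Even cycles *)

(** The lists are in cyclic order; the cycle is cut at its first vertex, which serves as both ends
    of a path. *)
Definition cycle_count (s : seq (seq nat)) : int :=
  if s is A :: s' then \sum_(a <- A) path_count s' a a else 0.

Lemma cycle_count_rot n s : cycle_count (rot n s) = cycle_count s.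
Proof.
have rot1E t : cycle_count (rot 1 t) = cycle_count t.
  case: t => [//|A [//|B t]]; rewrite rot1_cons /= -cats1.
  under eq_bigr do rewrite path_count_cat /=.
  rewrite exchange_big /=; apply: eq_bigr => a _; apply: eq_bigr => b _.
  by rewrite mulrC.
case: (leqP n (size s)) => [|/ltnW /rot_oversize -> //].
elim: n => [|n IH] ns; first by rewrite rot0.
by rewrite -add1n rotD // rot1E IH // ltnW.
Qed.

Lemma not_path_cat (T : Type) (r : rel T) x s : ~~ path r x s ->
  exists s1 y z s2, x :: s = s1 ++ y :: z :: s2 /\ ~~ r y z.
Proof.
elim: s x => [//|y s IH] x /=; case: (boolP (r x y)) => [_ /= /IH|rxy _].
  by move=> [s1 [u [v [s2 [-> h]]]]]; exists (x :: s1), u, v, s2.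
by exists [::], x, y, s.
Qed.

(** Color a path with [n] edges from a fixed first color, and let [b] be another color: the last
    vertex avoids [b] in [walk m n.+1] ways and has color [b] in [walk m n] ways. *)
Lemma walkD m n : walk m n.+1 + walk m n = (m%:R - 1) ^+ n.
Proof.
elim: n => [|n IH]; first by rewrite /= mulr0 add0r addr0 expr0.
by rewrite exprS -IH [walk m n.+2]/= [in RHS]/= exprS; rewrite /=; ring.
Qed.

Lemma walk_mul m n : m%:R * walk m n = (m%:R - 1) ^+ n - (-1) ^+ n.
Proof. by have := walkD m n; rewrite [walk m n.+1]/= => <-; ring. Qed.

Lemma walk_ge m n : (3 <= m)%N -> (3 <= n)%N -> m%:R <= walk m n.
Proof.
move=> m3; elim: n => [//|[//|[//|[|n]]] IH] _; first by rewrite /= !exprS expr0; nia.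
have {}IH := IH isT.
rewrite [walk _ _]/= -/(walk m n.+3) -signr_odd; move: IH; set w := walk m n.+3.
by case: (odd _) => /=; rewrite ?expr0 ?expr1; nia.
Qed.

(* If the lists are not all equal, rotate the cycle so that they change at its first edge:
   each color lost there leaves an extra [walk m n.-1 >= m] colorings. *)
Lemma even_cycle_count_ge m s : (3 <= m)%N -> (4 <= size s)%N -> ~~ odd (size s) ->
  all (is_list m) s -> m%:R * (walk m (size s) + 1) <= cycle_count s.
Proof.
move=> m3; case: s => [//|A s] s4 so vs.
have vA : is_list m A by move: vs => /= /andP[].
(* If consecutive lists agree up to order, all lists do, and the count is the ordinary one. *)
case: (boolP (path perm_eq A s)) => [pA|npA].
  have As := order_path_min (@perm_trans _) pA.
  have [uA /eqP sA] := andP vA.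
  rewrite [cycle_count _]/= -sA -sum_const.
  apply: ler_sum_seq => a aA.
  by rewrite (path_count_const uA As aA aA) eqxx -signr_odd (negPf so).
have [s1 [B [C [s2 [e nBC]]]]] := not_path_cat npA.
rewrite e in s4 so vs *.
rewrite -(cycle_count_rot (size s1)) rot_size_cat.
set t := s2 ++ s1.
have st : size (s1 ++ B :: C :: s2) = (size t).+2 by rewrite !size_cat /=; lia.
rewrite st in s4 so *.
have /and3P[vB vC vt] : all (is_list m) (B :: C :: t).
  by move: vs; rewrite /t /= !all_cat /= => /and4P[-> -> -> ->].
have [f fT fge] := path_count_ge (ltnW m3) vC vB vt.
rewrite [cycle_count _]/=.
set n := (size t).+1 in fge so s4 *.
have no : odd n by move: so; rewrite /= negbK.
have {}fge a b : a \in B -> b \in C ->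
    (1 - (b == a)%:R) * walk m n - (f b == a)%:R <= (a != b)%:R * path_count t b a.
  move=> aB bC; have := fge _ _ bC aB; rewrite -signr_odd no expr1.
  rewrite (eq_sym b) (eq_sym (f b)); move: (path_count _ _ _) (walk m n) => p w.
  clear; case: (a == b) => /=; rewrite ?mul0r ?mul1r; last by lia.
  by case: (_ == _); lia.
(* Two lists of size [m] that are not permutations of each other share fewer than [m] colors. *)
have mB : (count (mem B) C < m)%N.
  move: vB vC nBC => /andP[uB /eqP sB] /andP[uC /eqP sC]; apply: contraNltn => mC.
  have /allP CB : all (mem B) C by rewrite all_count eqn_leq count_size sC.
  rewrite perm_sym; apply: uniq_perm => // c.
  by have [|_ ->] := uniq_min_size uC CB; rewrite ?sB ?sC.
rewrite exchange_big /=.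
(* With [w = walk m n] and [k] common colors this sum is [m * (m * w - 1) - k * w]. Since [k < m]
   and [w >= m], it is at least [m * (m - 1) * w], which is the ordinary count because [n] is
   odd. *)
apply: le_trans (_ : \sum_(b <- C) (m%:R * walk m n - 1 - (b \in B)%:R * walk m n) <= _).
  rewrite sumrB sum_const -mulr_suml.
  have -> : \sum_(b <- C) (b \in B)%:R = (count (mem B) C)%:R :> int.
    by rewrite sum_indicator.
  have [_ /eqP ->] := andP vC.
  have := walk_ge m3 (_ : 3 <= n)%N.
  rewrite -[(_ - 1) * walk _ _ + _]/(walk m n) -signr_odd no expr1.
  move: mB (walk m n) => mB w /(_ ltac:(lia)); move: (count _ _) mB => k mB.
  by clear - m3 mB; nia.
apply: ler_sum_seq => b bC.
apply: le_trans (_ : \sum_(a <- B) ((1 - (b == a)%:R) * walk m n - (f b == a)%:R) <= _).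
  rewrite sumrB -mulr_suml sumrB sum_const.
  have S c : \sum_(a <- B) (c == a)%:R = (c \in B)%:R :> int.
    rewrite -[RHS]mulr1 -(sum_mem_eq (fun=> 1)); last by case/andP: vB.
    by apply: eq_bigr => a _; rewrite mulr1.
  rewrite !S (fT.1 _ bC); case/andP: vB => _ /eqP ->.
  by rewrite le_eqVlt; apply/orP; left; apply/eqP; rewrite /= ?mulr1n; ring.
by apply: ler_sum_seq => a aB; apply: fge.
Qed.

(** * Counts for theta graphs and their value for equal lists *)

Definition theta_count (A B : seq nat) (s1 s2 s3 : seq (seq nat)) : int :=
  \sum_(a <- A) \sum_(b <- B)
    path_count s1 a b * path_count s2 a b * path_count s3 a b.

(** The chromatic polynomial of the theta graph at [m]: the first summand has equal end colors, the
    second distinct ones. *)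
Definition theta_value (m l1 l2 l3 : nat) : int :=
  m%:R * ((walk m l1 + (-1) ^+ l1) * (walk m l2 + (-1) ^+ l2) * (walk m l3 + (-1) ^+ l3))
  + m%:R * (m%:R - 1) * (walk m l1 * walk m l2 * walk m l3).

Lemma theta_countACA A B s1 s2 s3 : theta_count A B s1 s3 s2 = theta_count A B s1 s2 s3.
Proof. by apply: eq_bigr => a _; apply: eq_bigr => b _; rewrite mulrAC. Qed.

Lemma theta_countCA A B s1 s2 s3 : theta_count A B s2 s1 s3 = theta_count A B s1 s2 s3.
Proof.
by apply: eq_bigr => a _; apply: eq_bigr => b _; rewrite [path_count s2 a b * _]mulrC.
Qed.

Lemma theta_valueACA m l1 l2 l3 : theta_value m l1 l3 l2 = theta_value m l1 l2 l3.
Proof. by rewrite /theta_value; ring. Qed.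

Lemma theta_valueCA m l1 l2 l3 : theta_value m l2 l1 l3 = theta_value m l1 l2 l3.
Proof. by rewrite /theta_value; ring. Qed.

Lemma sum_diag_split (A : seq nat) (x y : int) a : uniq A -> a \in A ->
  \sum_(b <- A) (x + y * (b == a)%:R) = (size A)%:R * x + y.
Proof.
move=> uA aA; rewrite big_split /= sum_const; congr (_ + _).
under eq_bigr do rewrite mulrC eq_sym.
by rewrite (sum_mem_eq (fun=> y)) // aA mul1r.
Qed.

Lemma theta_count_const A B s1 s2 s3 : uniq A -> perm_eq A B ->
  all (perm_eq A) s1 -> all (perm_eq A) s2 -> all (perm_eq A) s3 ->
  theta_count A B s1 s2 s3 = theta_value (size A) (size s1).+1 (size s2).+1 (size s3).+1.
Proof.
move=> uA AB A1 A2 A3.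
set l1 := (size s1).+1; set l2 := (size s2).+1; set l3 := (size s3).+1.
set w := walk (size A); set e := fun l => (-1) ^+ l : int.
transitivity (\sum_(a <- A) \sum_(b <- A) (w l1 * w l2 * w l3 +
    ((w l1 + e l1) * (w l2 + e l2) * (w l3 + e l3) - w l1 * w l2 * w l3) * (b == a)%:R)).
  apply: eq_big_seq => a aA; rewrite -(perm_big _ AB) /=.
  apply: eq_big_seq => b bA; rewrite (path_count_const uA A1 aA bA).
  rewrite (path_count_const uA A2 aA bA) (path_count_const uA A3 aA bA) -/l1 -/l2 -/l3 -/w.
  by rewrite -!/(e _); case: (b == a) => /=; ring.
rewrite (eq_big_seq _ (fun a aA => sum_diag_split _ _ uA aA)) sum_const.
by rewrite /theta_value -!/(e _) -!/(w _); ring.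
Qed.

Lemma path_count_ge0 s a b : 0 <= path_count s a b.
Proof.
elim: s a => [|C s IH] a; first exact: ler0n.
by apply: sumr_ge0 => c _; rewrite mulr_ge0.
Qed.

Lemma theta_count_ge0 A B s1 s2 s3 : 0 <= theta_count A B s1 s2 s3.
Proof.
by apply: sumr_ge0 => a _; apply: sumr_ge0 => b _; rewrite !mulr_ge0 ?path_count_ge0.
Qed.

(** Two paths with common ends form a cycle, the second one traversed backwards. *)
Lemma cycle_sum A B s1 s2 :
  \sum_(a <- A) \sum_(b <- B) path_count s1 a b * path_count s2 a b =
  cycle_count (A :: s1 ++ B :: rev s2).
Proof.
apply: eq_bigr => a _; rewrite path_count_cat.
by apply: eq_bigr => b _; rewrite path_count_rev.
Qed.

(** For positive lengths both sides count the ordinary colorings of an even cycle; the right side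
    separates equal from distinct colors at two vertices that cut it into paths of lengths [l1] and
    [l2]. *)
Lemma even_cycle_value m l1 l2 : odd l1 = odd l2 ->
  m%:R * (walk m (l1 + l2) + 1) =
  m%:R * ((walk m l1 + (-1) ^+ l1) * (walk m l2 + (-1) ^+ l2))
  + m%:R * (m%:R - 1) * (walk m l1 * walk m l2).
Proof.
move=> e; have h1 := walk_mul m l1; have h2 := walk_mul m l2.
rewrite mulrDr mulr1 walk_mul exprD.
have es : (-1) ^+ (l1 + l2) = 1 :> int by rewrite -signr_odd oddD e addbb.
have e12 : (-1) ^+ l2 = (-1) ^+ l1 :> int by rewrite -signr_odd -e signr_odd.
have e11 : (-1) ^+ l1 * (-1) ^+ l1 = 1 :> int by rewrite -exprD -signr_odd oddD addbb.
rewrite es; rewrite e12 in h2 *.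
have -> : (m%:R - 1) ^+ l1 = m%:R * walk m l1 + (-1) ^+ l1 :> int by rewrite h1 subrK.
have -> : (m%:R - 1) ^+ l2 = m%:R * walk m l2 + (-1) ^+ l1 :> int by rewrite h2 subrK.
move: ((-1) ^+ l1) e11 (walk m l1) (walk m l2) => u uu x y.
have -> : m%:R * ((x + u) * (y + u)) = m%:R * (x * y + u * (x + y)) + m%:R * (u * u) by ring.
have -> : (m%:R * x + u) * (m%:R * y + u) =
    m%:R * m%:R * x * y + m%:R * u * (x + y) + u * u by ring.
by rewrite uu; ring.
Qed.

(** * Lengths of different parity *)

Lemma theta_count_ge_odd_cycle m A B s1 s2 s3 : (3 <= m)%N ->
  is_list m A -> is_list m B ->
  all (is_list m) s1 -> all (is_list m) s2 -> all (is_list m) s3 ->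
  odd (size s1) = odd (size s2) -> odd (size s1) != odd (size s3) ->
  (2 <= size s1 + size s2)%N ->
  theta_value m (size s1).+1 (size s2).+1 (size s3).+1 <= theta_count A B s1 s2 s3.
Proof.
move=> m3 vA vB v1 v2 v3 o12 o13 s12; have m2 := ltnW m3.
set l1 := (size s1).+1; set l2 := (size s2).+1; set l3 := (size s3).+1.
have ol12 : odd l1 = odd l2 by rewrite /= o12.
have ol13 : odd l3 = ~~ odd l1 by rewrite /=; case: (odd _) o13; case: (odd _).
have [uA /eqP sA] := andP vA; have [uB /eqP sB] := andP vB.
have lower s : all (is_list m) s -> {in A & B, forall a b,
   walk m (size s).+1 - (odd (size s).+1)%:R <= path_count s a b}.
  move=> vs a b aA bB; have [f _ /(_ a b aA bB)] := path_count_ge m2 vA vB vs.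
  rewrite -signr_odd; apply: le_trans; rewrite lerD2l.
  by case: (odd _); case: (b == _).
pose N a b := path_count s1 a b * path_count s2 a b.
have NC : m%:R * ((walk m l1 + (-1) ^+ l1) * (walk m l2 + (-1) ^+ l2))
  + m%:R * (m%:R - 1) * (walk m l1 * walk m l2)
   <= \sum_(a <- A) \sum_(b <- B) N a b.
  rewrite -even_cycle_value // cycle_sum.
  have sz : size (A :: s1 ++ B :: rev s2) = (l1 + l2)%N.
    by rewrite /= size_cat /= size_rev addSn.
  rewrite -sz; apply: even_cycle_count_ge => //; rewrite ?sz.
  - by rewrite /l1 /l2 addSn addnS.
  - by rewrite oddD ol12 addbb.
  - by rewrite /= all_cat /= all_rev vA v1 vB v2.
have [f [fB fI] fge] := path_count_ge m2 vA vB v3.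
have N0 a b : 0 <= N a b by rewrite mulr_ge0 ?path_count_ge0.
have [w30 w31] := walk_even_odd l3 m2.
have [w10 w11] := walk_even_odd l1 m2.
have [w20 w21] := walk_even_odd l2 m2.
have Nge a b : a \in A -> b \in B ->
    (walk m l1 - (odd l1)%:R) * (walk m l2 - (odd l2)%:R) <= N a b.
  move=> aA bB; apply: ler_pM; rewrite ?lower ?subr_ge0 //.
    by case: (odd l1) w11 => // /(_ isT).
  by case: (odd l2) w21 => // /(_ isT).
pose w := walk m; rewrite -!/(w _) in NC w30 w31 w10 w11 w20 w21 Nge fge lower *.
have step : \sum_(a <- A) \sum_(b <- B) N a b * (w l3 + (-1) ^+ l3 * (b == f a)%:R)
    <= theta_count A B s1 s2 s3.
  apply: ler_sum_seq => a aA; apply: ler_sum_seq => b bB.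
  by apply: ler_wpM2l => //; apply: fge.
apply: le_trans step; rewrite /theta_value -!/(w _).
set S := \sum_(a <- A) _ in NC.
case o3 : (odd l3); rewrite o3 in ol13 w31.
  have {}w31 := w31 isT.
  rewrite -!(signr_odd _ l1) -!(signr_odd _ l2) -!(signr_odd _ l3) in NC *.
  rewrite -ol12 -(negbK (odd l1)) -ol13 o3 /= ?expr0 ?expr1 in NC Nge *.
  (* For odd [l3] the weight [w l3 - [b = f a]] is [(w l3 - 1) + [b <> f a]]. The first part uses
     the cycle bound, the second [N >= w l1 * w l2] at the [m * (m - 1)] pairs off the graph of
     [f]. *)
  apply: le_trans (_ : (w l3 - 1) * S + m%:R * ((m%:R - 1) * (w l1 * w l2)) <= _).
    have := ler_wpM2l (_ : 0 <= w l3 - 1) NC; rewrite subr_ge0 => /(_ w31) h.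
    by apply: (le_trans _ (lerD h (lexx _))); rewrite le_eqVlt; apply/orP; left; apply/eqP; ring.
  rewrite -sA -sum_const mulr_sumr -big_split /= sA.
  apply: ler_sum_seq => a aA; rewrite mulr_sumr.
  have -> : (m%:R - 1) * (w l1 * w l2) =
      \sum_(b <- B) (w l1 * w l2 - (f a == b)%:R * (w l1 * w l2)).
    by rewrite sumrB sum_const sum_mem_eq // fB // sB mul1r; ring.
  rewrite -big_split /=; apply: ler_sum_seq => b bB.
  have := Nge a b aA bB; rewrite !subr0 eq_sym.
  move: (N a b) (w l1 * w l2) (w l3) (b == f a) => u v t e.
  by clear; case: e => /=; lia.
rewrite -!(signr_odd _ l1) -!(signr_odd _ l2) -!(signr_odd _ l3) in NC *.
rewrite -ol12 -(negbK (odd l1)) -ol13 o3 /= ?expr0 ?expr1 in NC Nge *.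
(* For even [l3] the extra weight lies on the [m] pairs of the graph of [f], where
   [N >= (w l1 - 1) * (w l2 - 1)] because [l1] and [l2] are odd. *)
apply: le_trans (_ : w l3 * S + m%:R * ((w l1 - 1) * (w l2 - 1)) <= _).
  have h := ler_wpM2l w30 NC.
  by apply: (le_trans _ (lerD h (lexx _))); rewrite le_eqVlt; apply/orP; left; apply/eqP; ring.
rewrite -{1}sA -sum_const mulr_sumr -big_split /=.
apply: ler_sum_seq => a aA; rewrite mulr_sumr.
under [X in _ <= X]eq_bigr do rewrite mul1r mulrDr [_ * w l3]mulrC [_ * (_ == _)%:R]mulrC eq_sym.
by rewrite big_split /= lerD2l sum_mem_eq // fB // mul1r Nge // fB.
Qed.

(** * The graph K_{2,3} *)

Lemma path_count1 m L a b : is_list m L ->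
  path_count [:: L] a b =
    m%:R - (a \in L)%:R - (b \in L)%:R + (b == a)%:R * (a \in L)%:R.
Proof.
move=> /andP[uL /eqP sL] /=.
transitivity (\sum_(c <- L)
  (1 - (a == c)%:R * 1 - (b == c)%:R * 1 + (a == c)%:R * (b == c)%:R) : int).
  by apply: eq_bigr => c _; rewrite (eq_sym c b); case: (a == c); case: (b == c).
rewrite big_split !sumrB /= sum_const !sum_mem_eq // sL.
by ring.
Qed.

(** The two counts concern disjoint sets of colors, all taken from [L]. *)
Lemma count_list_le m A B L : is_list m A -> is_list m B -> is_list m L ->
  (count (mem L) A + count (fun b => (b \in L) && (b \notin A)) B <= m)%N.
Proof.
move=> /andP[uA _] /andP[uB _] /andP[uL /eqP <-].
rewrite -!size_filter -size_cat; apply: uniq_leq_size.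
  rewrite cat_uniq !filter_uniq // andbT /=.
  apply/hasPn => c; rewrite !mem_filter /= => /andP[/andP[_ cA] _].
  by rewrite (negPf cA) andbF.
by move=> c; rewrite mem_cat !mem_filter => /orP[/andP[]//|/andP[/andP[]]].
Qed.

(** The formula of [path_count1] at [m = 2], in [nat] and with booleans so that it computes; the
    truncated subtraction loses nothing. *)
Definition two_list_factor (e p q : bool) : nat := 2 - p - q + (e && p).

Lemma path_count1_two L a b : is_list 2 L ->
  path_count [:: L] a b = (two_list_factor (b == a) (a \in L) (b \in L))%:R.
Proof.
by move=> vL; rewrite (path_count1 a b vL); do 3!case: (_ == _) || case: (_ \in _).
Qed.

Definition bool_pairs : seq (bool * bool) :=
  [:: (true, true); (true, false); (false, true); (false, false)].

(* Membership patterns of one list in the lists [:: a1; a2] and [:: b1; b2], where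
   [eij] says whether [bj] is [ai]. *)
Definition patterns (e11 e12 e21 e22 : bool) : seq ((bool * bool) * (bool * bool)) :=
  [seq t : (bool * bool) * (bool * bool) <- [seq (p, q) | p <- bool_pairs, q <- bool_pairs] |
     let: ((p1, p2), (q1, q2)) := t in
     [&& e11 ==> (p1 == q1), e12 ==> (p1 == q2), e21 ==> (p2 == q1), e22 ==> (p2 == q2)
       & (p1 + p2 + (q1 && ~~ (e11 || e21)) + (q2 && ~~ (e12 || e22)) <= 2)%N]].

(** The index [i] runs over the pairs (a1,b1), (a1,b2), (a2,b1), (a2,b2). *)
Definition pattern_factor e11 e12 e21 e22 i (t : (bool * bool) * (bool * bool)) : nat :=
  let: ((p1, p2), (q1, q2)) := t in
  nth 0%N [:: two_list_factor e11 p1 q1; two_list_factor e12 p1 q2;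
           two_list_factor e21 p2 q1; two_list_factor e22 p2 q2] i.

(** A finite check by computation. The four hypotheses hold because the two colors within each end
    list differ. *)
Lemma patterns_check e11 e12 e21 e22 t1 t2 t3 :
  ~~ (e11 && e12) -> ~~ (e21 && e22) -> ~~ (e11 && e21) -> ~~ (e12 && e22) ->
  let s := patterns e11 e12 e21 e22 in let F := pattern_factor e11 e12 e21 e22 in
  t1 \in s -> t2 \in s -> t3 \in s ->
  (2 <= \sum_(i <- [:: 0; 1; 2; 3]) F i t1 * F i t2 * F i t3)%N.
Proof.
move=> h1 h2 h3 h4 s F s1 s2 s3; rewrite !big_cons big_nil.
suff /allP/(_ _ s1)/allP/(_ _ s2)/allP/(_ _ s3) : all (fun t1 => all (fun t2 => all (fun t3 =>
  2 <= F 0 t1 * F 0 t2 * F 0 t3 + (F 1 t1 * F 1 t2 * F 1 t3 + (F 2 t1 * F 2 t2 * F 2 t3 +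
       (F 3 t1 * F 3 t2 * F 3 t3 + 0))))%N s) s) s by [].
rewrite {s1 s2 s3}/s {s}/F {F t1 t2 t3}; move: h1 h2 h3 h4.
by case: e11; case: e12; case: e21; case: e22 => // _ _ _ _; vm_compute.
Qed.

Lemma K23_count_ge_two A B L1 L2 L3 :
  is_list 2 A -> is_list 2 B -> is_list 2 L1 -> is_list 2 L2 -> is_list 2 L3 ->
  2 <= theta_count A B [:: L1] [:: L2] [:: L3].
Proof.
move=> vA vB v1 v2 v3.
rewrite /theta_count.
under eq_bigr do under eq_bigr do
  rewrite (path_count1_two _ _ v1) (path_count1_two _ _ v2) (path_count1_two _ _ v3) -!natrM.
have cnt L := @count_list_le 2 A B L vA vB.
move: (vA) (vB) => /andP[uA /eqP sA] /andP[uB /eqP sB].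
case: A sA uA vA cnt => [|a1 [|a2 [|]]] // _ /=; rewrite inE andbT => na vA cnt.
case: B sB uB vB cnt => [|b1 [|b2 [|]]] // _ /=; rewrite inE andbT => nb vB cnt.
pose pat (L : seq nat) := ((a1 \in L, a2 \in L), (b1 \in L, b2 \in L)).
have patP L : is_list 2 L -> pat L \in patterns (b1 == a1) (b2 == a1) (b1 == a2) (b2 == a2).
  move=> /cnt; rewrite !inE !negb_or !addn0 !addnA /patterns mem_filter => h.
  apply/andP; split.
    apply/and5P; split; try by apply/implyP => /eqP ->.
    by rewrite !negb_or.
  by rewrite /pat; case: (a1 \in L); case: (a2 \in L); case: (b1 \in L); case: (b2 \in L).
have := patterns_check _ _ _ _ (patP _ v1) (patP _ v2) (patP _ v3).
rewrite !big_cons !big_nil /= !addr0 -!natrD -!addnA !addn0.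
move=> h; rewrite ler_nat; apply: h.
- by apply: contraNN nb => /andP[/eqP -> /eqP ->].
- by apply: contraNN nb => /andP[/eqP -> /eqP ->].
- by apply: contraNN na => /andP[/eqP <- /eqP <-].
- by apply: contraNN na => /andP[/eqP <- /eqP <-].
Qed.

(* [Theta(2,2,2)] is [K_{2,3}]. A list [L] misses at least [m - #|A :&: B|] colors of
   [A :|: B], and each missed color gives slack for at least [m] pairs [(a, b)]. *)
Lemma K23_slack m A B L : is_list m A -> is_list m B -> is_list m L ->
  m%:R * (m%:R - (count (mem A) B)%:R) <=
  \sum_(a <- A) \sum_(b <- B)
    ((a \notin L)%:R + (b \notin L)%:R - (b == a)%:R * (b \notin L)%:R) :> int.
Proof.
move=> vA vB vL; have cnt := count_list_le vA vB vL.
have [uA /eqP sA] := andP vA; have [uB /eqP sB] := andP vB.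
under eq_bigr do rewrite sumrB big_split /= sum_const sum_indicator.
rewrite sumrB big_split /= -mulr_sumr sum_const sum_indicator sA sB.
rewrite exchange_big /=.
under [X in _ <= _ - X]eq_bigr do rewrite sum_mem_eq //.
have -> : \sum_(b <- B) (b \in A)%:R * (b \notin L)%:R
    = (count (fun b => (b \in A) && (b \notin L)) B)%:R :> int.
  by rewrite -sum_indicator; apply: eq_bigr => b _; rewrite -natrM mulnb.
set k := count (mem A) B; set g := count (fun b => _ && _) B.
have cA : (count (mem L) A + count (fun a => a \notin L) A = m)%N.
  by rewrite -sA -(count_predC (mem L) A).
(* Every color of [B] is counted once on the left, except the [g] colors of [A] missed by [L], which
   are counted twice. *)
have cB : (count (fun b => (b \in L) && (b \notin A)) B
    + count (fun b => b \notin L) B + k = m + g)%N.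
  rewrite -{}sB /k /g; elim: (B) => [//|b B' IH] /=.
  move: IH; case: (b \in L); case: (b \in A) => /=; lia.
have gm : (g <= m)%N by rewrite -sB count_size.
move: cnt cA cB; set x := count _ A; set z := count _ B; set u := count _ A; set v := count _ B.
move=> cnt cA cB.
have h : (m%:R - k%:R : int) <= x%:R + z%:R - g%:R by lia.
have := ler_wpM2l (ler0n int m) h => {}h.
have gmg : g%:R <= m%:R * g%:R :> int by case: (m) gm => [|m']; [lia | nia].
by move: h gmg; clear; lia.
Qed.

Lemma K23_count_ge m A B L1 L2 L3 : (3 <= m)%N -> is_list m A -> is_list m B ->
  is_list m L1 -> is_list m L2 -> is_list m L3 ->
  theta_value m 2 2 2 <= theta_count A B [:: L1] [:: L2] [:: L3].
Proof.
move=> m3 vA vB v1 v2 v3.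
pose g (L : seq nat) (a b : nat) : int :=
  (a \notin L)%:R + (b \notin L)%:R - (b == a)%:R * (b \notin L)%:R.
set y : int := m%:R - 2; have y1 : 1 <= y by rewrite /y; lia.
have g0 L a b : 0 <= g L a b.
  by rewrite /g; case: (_ == _); case: (_ \notin _); case: (_ \notin _).
have pcE L a b : is_list m L -> path_count [:: L] a b = y + (b == a)%:R + g L a b.
  move=> vL; rewrite (path_count1 a b vL) /g /y.
  case: (eqVneq b a) => [->|_]; last by case: (a \in L); case: (b \in L) => /=; ring.
  by case: (a \in L) => /=; ring.
have [uA /eqP sA] := andP vA; have [uB /eqP sB] := andP vB.
pose G L := \sum_(a <- A) \sum_(b <- B) g L a b.
have GE L : is_list m L -> m%:R * (m%:R - (count (mem A) B)%:R) <= G L.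
  by move=> vL; apply: K23_slack.
clearbody g.
(* [c = (y + 1) ^+ 3 - y ^+ 3] is the gain of a pair of equal end colors. *)
pose c : int := 3 * y ^+ 2 + 3 * y + 1.
set k := count (mem A) B in GE.
have km : (k <= m)%N by rewrite -sB count_size.
apply: le_trans (_ : m%:R * (m%:R * y ^+ 3) + k%:R * c + y ^+ 2 * (G L1 + G L2 + G L3) <= _).
  have -> : theta_value m 2 2 2 = m%:R * (m%:R * y ^+ 3) + m%:R * c.
    by rewrite /theta_value /= /c /y; ring.
  have mE : (m%:R : int) = y + 2 by rewrite /y subrK.
  (* Each of the [m - k] missing equal pairs costs [c], while the three slacks together give at
     least [3 * m * y ^+ 2] for it, and [c <= 3 * y ^+ 2 * (y + 2)]. *)
  have h : (m%:R - k%:R) * c <= y ^+ 2 * (3 * (m%:R * (m%:R - k%:R))).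
    have -> : y ^+ 2 * (3 * (m%:R * (m%:R - k%:R))) = (m%:R - k%:R) * (3 * y ^+ 2 * (y + 2)).
      by rewrite mE; ring.
    by apply: ler_wpM2l; [lia | rewrite /c !expr2; nia].
  have := GE _ v1; have := GE _ v2; have := GE _ v3.
  move: (G L1) (G L2) (G L3) (m%:R * (m%:R - k%:R)) h => g1 g2 g3 t h h3 h2 h1.
  have h' := ler_wpM2l (sqr_ge0 y) (_ : 3 * t <= g1 + g2 + g3).
  have {}h' := le_trans h (h' ltac:(lia)).
  rewrite mulrBl in h'; move: h'; lia.
have -> : m%:R * (m%:R * y ^+ 3) + k%:R * c + y ^+ 2 * (G L1 + G L2 + G L3) =
    \sum_(a <- A) \sum_(b <- B) (y ^+ 3 + c * (a == b)%:R
       + y ^+ 2 * (g L1 a b + g L2 a b + g L3 a b)).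
  have e1 : \sum_(a <- A) \sum_(b <- B) c * (a == b)%:R = k%:R * c.
    rewrite mulrC /k -sum_indicator mulr_sumr exchange_big /=; apply: eq_bigr => b _.
    rewrite -mulr_sumr -[(b \in A)%:R]mulr1 -(sum_mem_eq (fun=> 1)) //.
    by congr (_ * _); apply: eq_bigr => a _; rewrite mulr1 eq_sym.
  have e2 : \sum_(a <- A) \sum_(b <- B) y ^+ 2 * (g L1 a b + g L2 a b + g L3 a b)
      = y ^+ 2 * (G L1 + G L2 + G L3).
    under eq_bigr do rewrite -mulr_sumr !big_split.
    by rewrite -mulr_sumr !big_split.
  under [RHS]eq_bigr do rewrite !big_split /= sum_const sB.
  by rewrite !big_split /= e1 e2 sum_const sA.
rewrite /theta_count; apply: ler_sum_seq => a _; apply: ler_sum_seq => b _.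
rewrite (pcE L1) // (pcE L2) // (pcE L3) // eq_sym.
move: (g0 L1 a b) (g0 L2 a b) (g0 L3 a b).
move: (g L1 a b) (g L2 a b) (g L3 a b) => u1 u2 u3 u1p u2p u3p.
(* Only the part linear in the slacks is kept; the terms of higher order are nonnegative. *)
have prod3 Y : y <= Y -> Y ^+ 3 + y ^+ 2 * (u1 + u2 + u3) <= (Y + u1) * (Y + u2) * (Y + u3).
  move=> yY; have Y0 : 0 <= Y by lia.
  have -> : (Y + u1) * (Y + u2) * (Y + u3) = Y ^+ 3 + Y ^+ 2 * (u1 + u2 + u3) +
      (Y * (u1 * u2 + u1 * u3 + u2 * u3) + u1 * u2 * u3) by ring.
  rewrite -[X in X <= _]addr0 lerD //; last by rewrite !(addr_ge0, mulr_ge0).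
  by rewrite lerD2l ler_wpM2r ?addr_ge0 // !expr2 ler_pM //; lia.
case: (b == a) => /=; last by rewrite mulr0 !addr0 prod3.
have -> : y ^+ 3 + c * 1 = (y + 1) ^+ 3 by rewrite /c; ring.
by apply: prod3; lia.
Qed.

(** * Equal parity: 2-assignments with at most one coloring *)

(** Starting from [a] in {0,1}, two vertices with list {0,1} are forced to [1 - a] and then [a], so
    nothing changes. *)
Lemma path_count_nseq k s a b : a \in [:: 0; 1]%N ->
  path_count (nseq k.*2 [:: 0; 1]%N ++ s) a b = path_count s a b.
Proof.
elim: k => [//|k IH] a01; rewrite doubleS /=.
move: a01 IH; rewrite !inE => /orP[] /eqP -> /(_ isT) IH;
  by rewrite !(big_cons, big_nil) /= !(mul0r, mul1r, add0r, addr0) IH.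
Qed.

Definition has_few_colorings (l1 l2 l3 : nat) : Prop :=
  exists A B s1 s2 s3,
    [/\ is_list 2 A && is_list 2 B,
        all (is_list 2) s1 && (size s1 == l1.-1),
        all (is_list 2) s2 && (size s2 == l2.-1),
        all (is_list 2) s3 && (size s3 == l3.-1)
      & theta_count A B s1 s2 s3 <= 1].

Lemma has_few_coloringsACA l1 l2 l3 :
  has_few_colorings l1 l2 l3 -> has_few_colorings l1 l3 l2.
Proof.
move=> [A [B [s1 [s2 [s3 [vAB v1 v2 v3 h]]]]]].
by exists A, B, s1, s3, s2; split; rewrite // theta_countACA.
Qed.

Lemma has_few_colorings_odd k1 k2 k3 :
  has_few_colorings k1.*2.+1 k2.*2.+3 k3.*2.+3.
Proof.
pose D := [:: 0; 1]%N.
(* The first path forces the end colors (0,1) or (1,0). The second path blocks (0,1) and the third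
   blocks (1,0), so no coloring remains. *)
exists D, D, (nseq k1.*2 D ++ [::]), (nseq k2.*2 D ++ [:: [:: 0; 2]; [:: 1; 2]]%N),
  (nseq k3.*2 D ++ [:: [:: 1; 2]; [:: 0; 2]]%N); split=> //.
- by rewrite all_cat all_nseq orbT size_cat size_nseq addn0 /=.
- by rewrite all_cat all_nseq orbT size_cat size_nseq addn2 /=.
- by rewrite all_cat all_nseq orbT size_cat size_nseq addn2 /=.
rewrite /theta_count big_seq.
under eq_bigr => a aD do under eq_bigr do rewrite !path_count_nseq //.
by rewrite -big_seq !(big_cons, big_nil) /= !(big_cons, big_nil).
Qed.

Lemma has_few_colorings_even k1 k2 k3 :
  has_few_colorings k1.*2.+2 k2.*2.+2 k3.*2.+4.
Proof.
pose D := [:: 0; 1]%N.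
(* The first path blocks the end colors (1,0), the second (1,2) and the third (0,0). The pair (0,2)
   extends in exactly one way. *)
exists D, [:: 0; 2]%N, (nseq k1.*2 D ++ [:: D]), (nseq k2.*2 D ++ [:: [:: 1; 2]]%N),
  (nseq k3.*2 D ++ [:: D; [:: 1; 2]; [:: 0; 2]]%N); split=> //.
- by rewrite all_cat all_nseq orbT size_cat size_nseq addn1 /=.
- by rewrite all_cat all_nseq orbT size_cat size_nseq addn1 /=.
- by rewrite all_cat all_nseq orbT size_cat size_nseq addn3 /=.
rewrite /theta_count big_seq.
under eq_bigr => a aD do under eq_bigr do rewrite !path_count_nseq //.
by rewrite -big_seq !(big_cons, big_nil) /= !(big_cons, big_nil).
Qed.

Lemma theta_has_few_colorings l1 l2 l3 : (0 < l1)%N -> (l1 <= l2)%N -> (l1 <= l3)%N ->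
  (2 <= l2)%N -> (2 <= l3)%N -> odd l1 = odd l2 -> odd l2 = odd l3 ->
  ~ (l1 = 2 /\ l2 = 2 /\ l3 = 2)%N -> has_few_colorings l1 l2 l3.
Proof.
move=> l1_gt0 l12 l13 l2_gt1 l3_gt1 o12 o23 n2.
case o1 : (odd l1).
  have -> : l1 = l1./2.*2.+1 by lia.
  have -> : l2 = (l2 - 3)./2.*2.+3 by lia.
  have -> : l3 = (l3 - 3)./2.*2.+3 by lia.
  exact: has_few_colorings_odd.
have -> : l1 = (l1 - 2)./2.*2.+2 by lia.
(* Not all lengths are 2, so [l2] or [l3] is at least 4; by symmetry it can be put last. *)
case: (leqP 4 l3) => h3; last apply: has_few_coloringsACA.
  have -> : l2 = (l2 - 2)./2.*2.+2 by lia.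
  have -> : l3 = (l3 - 4)./2.*2.+4 by lia.
  exact: has_few_colorings_even.
have -> : l3 = (l3 - 2)./2.*2.+2 by lia.
have -> : l2 = (l2 - 4)./2.*2.+4 by lia.
exact: has_few_colorings_even.
Qed.

(** * Small [m] and the general lower bound *)

Lemma walk_two l : walk 2 l = (odd l)%:R.
Proof. by elim: l => [//|l IH] /=; rewrite IH -signr_odd; case: (odd l). Qed.

Lemma theta_value_two l1 l2 l3 : theta_value 2 l1 l2 l3 =
  if (odd l1 == odd l2) && (odd l2 == odd l3) then 2 else 0.
Proof.
rewrite /theta_value !walk_two -!(signr_odd _ l1) -!(signr_odd _ l2) -!(signr_odd _ l3).
by case: (odd l1); case: (odd l2); case: (odd l3).
Qed.

Lemma walk_one l : walk 1 l.+1 = (-1) ^+ l.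
Proof. by rewrite /= mul0r add0r. Qed.

Lemma theta_count_ge m A B s1 s2 s3 :
  is_list m A -> is_list m B ->
  all (is_list m) s1 -> all (is_list m) s2 -> all (is_list m) s3 ->
  let l1 := (size s1).+1 in let l2 := (size s2).+1 in let l3 := (size s3).+1 in
  (l1 <= l2)%N -> (l1 <= l3)%N -> (2 <= l2)%N -> (2 <= l3)%N ->
  ~~ ((odd l1 == odd l2) && (odd l2 == odd l3)) || [&& l1 == 2, l2 == 2 & l3 == 2]%N ->
  theta_value m l1 l2 l3 <= theta_count A B s1 s2 s3.
Proof.
move=> vA vB v1 v2 v3 l1 l2 l3 l12 l13 l2_gt1 l3_gt1.
have [m3|] := leqP 3 m; last first.
  case: m vA vB v1 v2 v3 => [|[|[|//]]] vA vB v1 v2 v3 _ h.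
  - by rewrite /theta_value !mul0r addr0 theta_count_ge0.
  - rewrite /theta_value /l1 !walk_one !exprS mulN1r.
    by rewrite !(subrr, mul0r, mulr0, add0r) theta_count_ge0.
  rewrite theta_value_two; case: ifP h => [_|_ _] /=; last exact: theta_count_ge0.
  case/and3P; rewrite /l1 /l2 /l3 !eqSS => /eqP z1 /eqP z2 /eqP z3.
  case: s1 s2 s3 z1 z2 z3 v1 v2 v3 {l1 l2 l3 l12 l13 l2_gt1 l3_gt1} =>
    [//|L1 []] // [//|L2 []] // [//|L3 []] // _ _ _ /=; rewrite !andbT.
  exact: K23_count_ge_two.
case/orP => [|/and3P[]]; last first.
  rewrite /l1 /l2 /l3 !eqSS => /eqP z1 /eqP z2 /eqP z3.
  case: s1 s2 s3 z1 z2 z3 v1 v2 v3 {l1 l2 l3 l12 l13 l2_gt1 l3_gt1} =>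
    [//|L1 []] // [//|L2 []] // [//|L3 []] // _ _ _ /=; rewrite !andbT.
  exact: K23_count_ge.
rewrite /l1 /l2 /l3 /=.
(* Two of the three lengths share a parity; the symmetries of the count bring them to the front. *)
case: (eqVneq (odd (size s1)) (odd (size s2))) => [e12 n|n12 _].
  apply: theta_count_ge_odd_cycle => //; last by lia.
  by move: n; rewrite e12 eqxx /= (inj_eq negb_inj).
case: (eqVneq (odd (size s1)) (odd (size s3))) => [e13|n13].
  rewrite -theta_valueACA -theta_countACA.
  by apply: theta_count_ge_odd_cycle => //; lia.
rewrite -theta_valueCA -theta_valueACA -theta_countCA -theta_countACA.
by apply: theta_count_ge_odd_cycle => //; lia.
Qed.

(** * From colorings of the graph to path counts *)

Definition bounded (K : nat) (C : seq nat) : bool := all (fun c => c < K)%N C.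

Lemma sum_ord_mem K (C : seq nat) (F : nat -> int) : uniq C -> bounded K C ->
  \sum_(c < K) ((c : nat) \in C)%:R * F c = \sum_(c <- C) F c.
Proof.
move=> uC /allP CK; rewrite -(big_mkord predT (fun c => (c \in C)%:R * F c)) /=.
transitivity (\sum_(0 <= c < K | c \in C) F c).
  rewrite [RHS]big_mkcond; apply: eq_bigr => c _.
  by case: (c \in C); rewrite ?mul1r ?mul0r.
rewrite -[LHS]big_filter; apply: perm_big; apply: uniq_perm => //.
  by rewrite filter_uniq // iota_uniq.
move=> c; rewrite mem_filter mem_index_iota /=.
by case: (boolP (c \in C)) => // /CK ->.
Qed.

Definition list_path (s : seq (seq nat)) (a : nat) (t : seq nat) (b : nat) : bool :=
  all2 (fun c C => c \in C) t s && path (fun x y => x != y) a (rcons t b).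

Lemma sum_list_path K s n a b : size s = n -> all uniq s -> all (bounded K) s ->
  \sum_(t : n.-tuple 'I_K) (list_path s a (map val t) b)%:R = path_count s a b :> int.
Proof.
elim: s n a => [|C s IH] n a <- /=.
  move=> _ _; rewrite (big_pred1 [tuple]) => [|t]; last first.
    by symmetry; apply/eqP; rewrite [LHS]tuple0.
  by rewrite /list_path /= andbT.
move=> /andP[uC us] /andP[bC bs].
rewrite (reindex (fun p : 'I_K * (size s).-tuple 'I_K => [tuple of p.1 :: p.2])) /=; last first.
  apply: onW_bij; exists (fun t => (thead t, [tuple of behead t])).
    by move=> [c t] /=; congr (_, _); apply: val_inj.
  by move=> t; rewrite [t in RHS]tuple_eta.
rewrite -(pair_bigA _ (fun c t =>
  (list_path (C :: s) a (map val (val [tuple of c :: tval t])) b)%:R : int)) /=.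
rewrite -(sum_ord_mem (fun c => (a != c)%:R * path_count s c b) uC bC).
apply: eq_bigr => c _; rewrite -(IH (size s)) // !mulr_sumr.
apply: eq_bigr => t _; rewrite -!natrM !mulnb /list_path /=.
by congr (nat_of_bool _)%:R; case: (_ \in C); case: (a != c); rewrite /= ?andbF.
Qed.

Section ThetaColorings.
Variables l1 l2 l3 : nat.
Hypothesis len_gt0 : forall i, (0 < theta_len l1 l2 l3 i)%N.
Local Notation len := (theta_len l1 l2 l3).
Local Notation V := (theta_vertex l1 l2 l3).

Definition inner (i : 'I_3) (k : 'I_(len i).-1) : V := inr (existT _ i k).
Definition along (T : Type) (f : V -> T) (i : 'I_3) : seq T :=
  [seq f (inner k) | k <- enum 'I_(len i).-1].
Definition theta_path (i : 'I_3) : seq V := inl false :: rcons (along id i) (inl true).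

Lemma size_along T (f : V -> T) i : size (along f i) = (len i).-1.
Proof. by rewrite size_map size_enum_ord. Qed.

Lemma nth_theta_path_inner x0 i (k : 'I_(len i).-1) : nth x0 (theta_path i) k.+1 = inner k.
Proof.
rewrite /= nth_rcons size_along ltn_ord (nth_map k) ?size_enum_ord //.
by rewrite nth_ord_enum.
Qed.

Lemma nth_theta_path_last x0 i : nth x0 (theta_path i) (len i) = inl true.
Proof.
by rewrite -[in LHS](prednK (len_gt0 i)) /= nth_rcons size_along ltnn eqxx.
Qed.

(** Positions are indices in [theta_path i], so adjacency means being consecutive in one of these
    sequences. *)
Lemma theta_posP x0 i x p :
  theta_pos i x = Some p <-> (p <= len i)%N /\ nth x0 (theta_path i) p = x.
Proof.
split.
  case: x => [[|]|[j k]] /=.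
  - by move=> [<-]; rewrite nth_theta_path_last.
  - by move=> [<-].
  case: eqP => // e; case: i / e p => p [<-]; split.
    by have := ltn_ord k; have := len_gt0 j; lia.
  exact: nth_theta_path_inner.
move=> [pl <-]; case: p pl => [//|p] pl.
have [lt|ge] := ltnP p (len i).-1.
  by rewrite (nth_theta_path_inner x0 (Ordinal lt)) /= eqxx.
have -> : p.+1 = len i by lia.
by rewrite nth_theta_path_last.
Qed.

Lemma proper_theta (f : V -> nat) :
  proper_coloring (theta_adj l1 l2 l3) f =
  [forall i, path (fun x y => x != y) (f (inl false)) (rcons (along f i) (f (inl true)))].
Proof.
pose x0 : V := inl false.
have E i : path (fun x y => x != y) (f (inl false)) (rcons (along f i) (f (inl true)))
    = path (fun x y => f x != f y) (inl false) (rcons (along id i) (inl true)).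
  have -> : rcons (along f i) (f (inl true)) = map f (rcons (along id i) (inl true)).
    by rewrite map_rcons -map_comp.
  by rewrite path_map.
have P i : reflect (forall p, (p < len i)%N ->
      f (nth x0 (theta_path i) p) != f (nth x0 (theta_path i) p.+1))
    (path (fun x y => x != y) (f (inl false)) (rcons (along f i) (f (inl true)))).
  rewrite E; apply: (iffP (pathP x0)); rewrite size_rcons size_along prednK //.
apply/idP/idP => [/forallP h|/forallP h].
  apply/forallP => i; apply/P => p lp.
  have /forallP/(_ (nth x0 (theta_path i) p.+1))/implyP := h (nth x0 (theta_path i) p).
  apply; apply/existsP; exists i.
  have posE q : (q <= len i)%N -> theta_pos i (nth x0 (theta_path i) q) = Some q.
    by move=> lq; apply/(theta_posP x0).
  by rewrite !posE ?eqxx // ltnW.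
apply/forallP => x; apply/forallP => y; apply/implyP => /existsP[i].
case ex: (theta_pos i x) => [p|//]; case ey: (theta_pos i y) => [q|//].
have [pl <-] := (theta_posP x0 i x p).1 ex; have [ql <-] := (theta_posP x0 i y q).1 ey.
have /P hi := h i.
by case/orP => /eqP e; [|rewrite eq_sym]; rewrite -e hi // e.
Qed.

Lemma all2_map2 (S T U : Type) (r : T -> U -> bool) (f : S -> T) (g : S -> U) s :
  all2 r (map f s) (map g s) = all (fun x => r (f x) (g x)) s.
Proof. by elim: s => //= x s ->. Qed.

Lemma list_coloring_theta (L : V -> seq nat) (f : V -> nat) :
  [forall v, f v \in L v] && proper_coloring (theta_adj l1 l2 l3) f =
  [&& f (inl false) \in L (inl false), f (inl true) \in L (inl true)
    & [forall i, list_path (along L i) (f (inl false)) (along f i) (f (inl true))]].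
Proof.
rewrite proper_theta /list_path; apply/andP/and3P => [[/forallP fL /forallP h]|].
  split=> //; apply/forallP => i; rewrite h andbT all2_map2.
  by apply/allP => k _.
move=> [fu fw /forallP h]; split; apply/forallP.
  move=> [[]|[i k]] //.
  have /andP[] := h i; rewrite all2_map2 => /allP/(_ k) + _; apply.
  by rewrite mem_enum.
by move=> i; have /andP[] := h i.
Qed.

End ThetaColorings.

Definition ord3_0 : 'I_3 := @Ordinal 3 0 isT.
Definition ord3_1 : 'I_3 := @Ordinal 3 1 isT.
Definition ord3_2 : 'I_3 := @Ordinal 3 2 isT.

Lemma ord3P (P : 'I_3 -> Prop) : P ord3_0 -> P ord3_1 -> P ord3_2 -> forall i, P i.
Proof.
move=> P0 P1 P2 [[|[|[|//]]] h].
- by rewrite (_ : Ordinal h = ord3_0) //; apply: val_inj.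
- by rewrite (_ : Ordinal h = ord3_1) //; apply: val_inj.
- by rewrite (_ : Ordinal h = ord3_2) //; apply: val_inj.
Qed.

Lemma forall_ord3 (P : pred 'I_3) :
  [forall i, P i] = [&& P ord3_0, P ord3_1 & P ord3_2].
Proof.
apply/forallP/and3P => [h|[h0 h1 h2]]; first by split.
exact: ord3P.
Qed.

Lemma sum_prod (S T : finType) (G : S * T -> int) :
  \sum_p G p = \sum_a \sum_b G (a, b).
Proof. by rewrite pair_bigA; apply: eq_bigr => -[]. Qed.

(* The default [a] of [nth] is never reached; it avoids a dependent match on [i]. *)
Definition theta_coloring_of (l1 l2 l3 K : nat)
    (p : ('I_K * 'I_K) * (l1.-1.-tuple 'I_K * (l2.-1.-tuple 'I_K * l3.-1.-tuple 'I_K)))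
    : {ffun theta_vertex l1 l2 l3 -> 'I_K} :=
  let: ((a, b), (t1, (t2, t3))) := p in
  [ffun v : theta_vertex l1 l2 l3 => match v with
             | inl false => a
             | inl true => b
             | inr (existT i k) => nth a (nth [::] [:: tval t1; tval t2; tval t3] (i : 'I_3)) k
             end].

Lemma theta_coloring_of_bij l1 l2 l3 K : bijective (@theta_coloring_of l1 l2 l3 K).
Proof.
exists (fun f : {ffun theta_vertex l1 l2 l3 -> 'I_K} => ((f (inl false), f (inl true)),
  ([tuple f (@inner l1 l2 l3 ord3_0 k) | k < l1.-1],
   ([tuple f (@inner l1 l2 l3 ord3_1 k) | k < l2.-1],
    [tuple f (@inner l1 l2 l3 ord3_2 k) | k < l3.-1])))).
  move=> [[a b] [t1 [t2 t3]]]; rewrite !ffunE; congr (_, (_, (_, _))).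
  - by apply: eq_from_tnth => k; rewrite tnth_mktuple ffunE (tnth_nth a).
  - by apply: eq_from_tnth => k; rewrite tnth_mktuple ffunE (tnth_nth a).
  - by apply: eq_from_tnth => k; rewrite tnth_mktuple ffunE (tnth_nth a).
move=> f; apply/ffunP => v; rewrite ffunE; case: v => [[]|[i k]] //.
by move: i k; apply: ord3P => k; apply: nth_mktuple.
Qed.

Lemma along_theta_coloring l1 l2 l3 K a b t1 t2 t3 i :
  along (fun v => @theta_coloring_of l1 l2 l3 K ((a, b), (t1, (t2, t3))) v : nat) i
  = map val (nth [::] [:: tval t1; tval t2; tval t3] i).
Proof.
have E n (t : n.-tuple 'I_K) : [seq (nth a (tval t) k : nat) | k : 'I_n] = map val t.
  by rewrite -[in RHS](map_tnth_enum t) -map_comp; apply: eq_map => k /=; rewrite (tnth_nth a).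
move: i; apply: ord3P; rewrite -E; apply: eq_map => k; by rewrite ffunE.
Qed.

(** A coloring amounts to two end colors and three tuples, and its validity splits into one
    condition per path. The bound [K] is free, so that both [color_bound L] and [m] can be used. *)
Lemma card_theta_colorings l1 l2 l3 K (L : theta_vertex l1 l2 l3 -> seq nat) :
  (forall i, (0 < theta_len l1 l2 l3 i)%N) ->
  (forall v, uniq (L v) && bounded K (L v)) ->
  #|[set f : {ffun theta_vertex l1 l2 l3 -> 'I_K} |
      [forall v, (f v : nat) \in L v]
      && proper_coloring (theta_adj l1 l2 l3) (fun v => (f v : nat))]|%:R =
  theta_count (L (inl false)) (L (inl true))
    (along L ord3_0) (along L ord3_1) (along L ord3_2).
Proof.
move=> len_gt0 hL.
have uL v : uniq (L v) by have /andP[] := hL v.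
have bL v : bounded K (L v) by have /andP[] := hL v.
have au i : all uniq (along L i) by rewrite all_map; apply/allP => k _; apply: uL.
have ab i : all (bounded K) (along L i) by rewrite all_map; apply/allP => k _; apply: bL.
rewrite -sum1_card natr_sum big_mkcond /=.
rewrite (reindex _ (onW_bij _ (theta_coloring_of_bij l1 l2 l3 K))) /=.
rewrite sum_prod sum_prod /=.
rewrite /theta_count.
rewrite -(sum_ord_mem (fun a => \sum_(b <- L (inl true)) _) (uL _) (bL _)).
apply: eq_bigr => a _.
rewrite -(sum_ord_mem (fun b => path_count _ a b * path_count _ a b * path_count _ a b)
  (uL _) (bL _)).
rewrite mulr_sumr; apply: eq_bigr => b _.
have P t1 t2 t3 : (if theta_coloring_of ((a, b), (t1, (t2, t3))) \in
    [set f : {ffun theta_vertex l1 l2 l3 -> 'I_K} |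
      [forall v, (f v : nat) \in L v]
      && proper_coloring (theta_adj l1 l2 l3) (fun v => (f v : nat))] then 1 else 0 : int)
  = ((a : nat) \in L (inl false))%:R * (((b : nat) \in L (inl true))%:R *
     ((list_path (along L ord3_0) a (map val t1) b)%:R *
     (list_path (along L ord3_1) a (map val t2) b)%:R *
     (list_path (along L ord3_2) a (map val t3) b)%:R)).
  rewrite inE list_coloring_theta // forall_ord3 !along_theta_coloring /= !ffunE.
  case: (_ \in L (inl false)); case: (_ \in L (inl true)) => /=;
    rewrite ?mul0r ?mulr0 ?mul1r //.
  by case: (list_path (along L ord3_0) _ _ _); case: (list_path (along L ord3_1) _ _ _);
    case: (list_path (along L ord3_2) _ _ _).
transitivity (\sum_(t1 : l1.-1.-tuple 'I_K) \sum_(t2 : l2.-1.-tuple 'I_K)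
   \sum_(t3 : l3.-1.-tuple 'I_K)
     ((a : nat) \in L (inl false))%:R * (((b : nat) \in L (inl true))%:R *
     ((list_path (along L ord3_0) a (map val t1) b)%:R *
     (list_path (along L ord3_1) a (map val t2) b)%:R *
     (list_path (along L ord3_2) a (map val t3) b)%:R)) : int).
  rewrite sum_prod; apply: eq_bigr => t1 _; rewrite sum_prod.
  by apply: eq_bigr => t2 _; apply: eq_bigr => t3 _; rewrite -P.
rewrite -(@sum_list_path K _ _ a b (size_along L ord3_0) (au _) (ab _)).
rewrite -(@sum_list_path K _ _ a b (size_along L ord3_1) (au _) (ab _)).
rewrite -(@sum_list_path K _ _ a b (size_along L ord3_2) (au _) (ab _)).
rewrite !mulr_suml !mulr_sumr; apply: eq_bigr => t1 _.
rewrite -[_ * _ * (\sum_t _)]mulrA mulr_suml !mulr_sumr; apply: eq_bigr => t2 _.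
by rewrite !mulr_sumr; apply: eq_bigr => t3 _; rewrite !mulrA.
Qed.

Lemma color_bound_le (V : finType) (L : V -> seq nat) v :
  bounded (color_bound L) (L v).
Proof.
apply/allP => c cL; rewrite ltnS.
apply: leq_trans (leq_bigmax v); exact: leq_bigmax_seq.
Qed.

Lemma chrom_polyE (V : finType) (e : rel V) m :
  chrom_poly e m = #|[set f : {ffun V -> 'I_m} |
    [forall v, (f v : nat) \in iota 0 m] && proper_coloring e (fun v => (f v : nat))]|.
Proof.
apply: eq_card => f; rewrite !inE.
have -> // : [forall v, (f v : nat) \in iota 0 m].
by apply/forallP => v; rewrite mem_iota ltn_ord.
Qed.

Lemma theta_len_gt0 l1 l2 l3 :
  (0 < l1)%N -> (0 < l2)%N -> (0 < l3)%N -> forall i, (0 < theta_len l1 l2 l3 i)%N.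
Proof. by move=> h1 h2 h3; apply: ord3P. Qed.

Lemma num_L_colorings_theta l1 l2 l3 (L : theta_vertex l1 l2 l3 -> seq nat) :
  (forall i, (0 < theta_len l1 l2 l3 i)%N) -> (forall v, uniq (L v)) ->
  (num_L_colorings (theta_adj l1 l2 l3) L)%:R =
  theta_count (L (inl false)) (L (inl true))
    (along L ord3_0) (along L ord3_1) (along L ord3_2).
Proof.
move=> len_gt0 uL; rewrite -(card_theta_colorings (K := color_bound L)) // => v.
by rewrite uL color_bound_le.
Qed.

Lemma theta_count_iota l1 l2 l3 m :
  (forall i, (0 < theta_len l1 l2 l3 i)%N) ->
  let L := fun _ : theta_vertex l1 l2 l3 => iota 0 m in
  theta_count (L (inl false)) (L (inl true)) (along L ord3_0) (along L ord3_1) (along L ord3_2)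
  = theta_value m l1 l2 l3.
Proof.
move=> len_gt0 L.
have aL i : all (perm_eq (iota 0 m)) (along L i) by rewrite all_map; apply/allP => k _ /=.
rewrite theta_count_const ?iota_uniq ?perm_refl // !size_along size_iota.
by rewrite !prednK ?len_gt0.
Qed.

Lemma chrom_poly_theta l1 l2 l3 m :
  (forall i, (0 < theta_len l1 l2 l3 i)%N) ->
  (chrom_poly (theta_adj l1 l2 l3) m)%:R = theta_value m l1 l2 l3.
Proof.
move=> len_gt0; rewrite -(theta_count_iota m len_gt0) chrom_polyE.
apply: (card_theta_colorings (L := fun=> iota 0 m)) => // v; rewrite iota_uniq /=.
by apply/allP => c; rewrite mem_iota.
Qed.

Lemma m_assignment_is_list (V : finType) (L : V -> seq nat) m v :
  m_assignment L m -> is_list m (L v).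
Proof. by move=> /(_ v) [u s]; rewrite /is_list u s eqxx. Qed.

(* The characterization *)
Local Close Scope ring_scope.

Theorem theorem1p4 (l1 l2 l3 : nat) :
  0 < l1 -> l1 <= l2 -> l1 <= l3 -> 2 <= l2 -> 2 <= l3 ->
  (~ enum_chromatic_choosable (theta_adj l1 l2 l3) <->
   (odd l1 = odd l2 /\ odd l2 = odd l3 /\ ~ (l1 = 2 /\ l2 = 2 /\ l3 = 2))).
Proof.
move=> l1_gt0 l12 l13 l2_gt1 l3_gt1.
have len_gt0 := theta_len_gt0 l1_gt0 (ltnW l2_gt1) (ltnW l3_gt1).
split=> [nECC | [o12 [o23 n2]] ECC].
  (* As a boolean, the condition may be proved by contradiction. *)
  pose good := ((odd l1 == odd l2) && (odd l2 == odd l3)) && ~~ [&& l1 == 2, l2 == 2 & l3 == 2].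
  suff : good.
    case/andP=> /andP[/eqP -> /eqP ->] /and3P h; split=> //; split=> // -[e1 [e2 e3]].
    by apply: h; rewrite e1 e2 e3.
  apply/negPn/negP => ngood; apply: nECC => m; split.
    (* The constant assignment attains the value P(G,m). *)
    exists (fun=> iota 0 m); split; first by move=> v; rewrite iota_uniq size_iota.
    apply/eqP; rewrite -(eqr_nat int) num_L_colorings_theta ?theta_count_iota //.
      by rewrite chrom_poly_theta.
    by move=> v; rewrite iota_uniq.
  move=> L hL; have vL v := m_assignment_is_list v hL.
  have vA i : all (is_list m) (along L i) by rewrite all_map; apply/allP => k _; apply: vL.
  rewrite -(ler_nat int) chrom_poly_theta // num_L_colorings_theta //; last first.
    by move=> v; case: (hL v).
  have := theta_count_ge (vL (inl false)) (vL (inl true)) (vA ord3_0) (vA ord3_1) (vA ord3_2).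
  cbv zeta; rewrite !size_along !prednK ?len_gt0 //; apply=> //.
  by move: ngood; rewrite /good negb_and negbK.
have [A [B [s1 [s2 [s3]]]]] :=
  theta_has_few_colorings l1_gt0 l12 l13 l2_gt1 l3_gt1 o12 o23 n2.
move=> [/andP[vA vB] /andP[v1 /eqP z1] /andP[v2 /eqP z2] /andP[v3 /eqP z3] few].
(* The lists are put on the vertices; the default lists of [nth] are never reached. *)
pose L (v : theta_vertex l1 l2 l3) := match v with
  | inl false => A
  | inl true => B
  | inr (existT i k) => nth [::] (nth [::] [:: s1; s2; s3] (i : 'I_3)) k
  end.
have alongL i : along L i = nth [::] [:: s1; s2; s3] i.
  apply: (@eq_from_nth _ [::]); rewrite size_along.
    by move: i; apply: ord3P; rewrite /= ?z1 ?z2 ?z3.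
  move=> k kn; rewrite (nth_map (Ordinal kn)) ?size_enum_ord //.
  by rewrite (nth_ord_enum _ (Ordinal kn)).
have vL v : is_list 2 (L v).
  case: v => [[|]|[i k]] //=; apply: (allP _); last apply: mem_nth.
    by move: i k; apply: ord3P.
  by move: i k; apply: ord3P => k; rewrite /= ?z1 ?z2 ?z3.
have uL v : uniq (L v) by have /andP[] := vL v.
have hL : m_assignment L 2 by move=> v; have /andP[-> /eqP ->] := vL v.
have [_ /(_ L hL)] := ECC 2.
rewrite -(ler_nat int) chrom_poly_theta // num_L_colorings_theta // !alongL /=.
(* Here P(G,2) = 2, while [L] admits at most one coloring. *)
rewrite theta_value_two o12 o23 !eqxx /= => h.
by have := le_trans h few.
Qed.
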